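(* Let $n\in\mathbb{N}$, $n\geqslant 1$, and let $\alpha\in\mathcal{I}_n$ be a partial permutation (injective partial transformation) of the chain $\Omega_n=\{1<2<\cdots<n\}$. Then: (1) $\alpha\in\mathcal{POPI}_n$ if and only if every restriction of $\alpha$ of width three belongs to $\mathcal{POPI}_n$; (2) $\alpha\in\mathcal{PORI}_n$ if and only if every restriction of $\alpha$ of width four belongs to $\mathcal{PORI}_n$.
   Context: $\Omega_n=\{1<2<\cdots<n\}$ is a finite chain. $\mathcal{PT}_n$ is the set (monoid) of all partial transformations on $\Omega_n$ (partial maps $\Omega_n\to\Omega_n$), and $\mathcal{I}_n$ is the symmetric inverse monoid on $\Omega_n$, i.e. the set of all injective elements of $\mathcal{PT}_n$. The image of $x\in\mathrm{Dom}(\alpha)$ under $\alpha$ is written $x\alpha$. A finite sequence $(a_1,\ldots,a_t)$ ($t\geqslant 0$) of elements of $\Omega_n$ is cyclic [anti-cyclic] if there is at most one index $i\in\{1,\ldots,t\}$ such that $a_i>a_{i+1}$ [$a_i<a_{i+1}$], where $a_{t+1}$ denotes $a_1$. It is oriented if it is cyclic or anti-cyclic. A partial transformation $\alpha\in\mathcal{PT}_n$ with $\mathrm{Dom}(\alpha)=\{a_1<\cdots<a_t\}$ ($t\geqslant 0$) is orientation-preserving [oriented] if its sequence of images $(a_1\alpha,\ldots,a_t\alpha)$ is cyclic [oriented]. $\mathcal{POP}_n$ is the set of all orientation-preserving $\alpha\in\mathcal{PT}_n$, and $\mathcal{POR}_n$ is the set of all oriented $\alpha\in\mathcal{PT}_n$;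 $\mathcal{POPI}_n=\mathcal{POP}_n\cap\mathcal{I}_n$ and $\mathcal{PORI}_n=\mathcal{POR}_n\cap\mathcal{I}_n$. The width of a partial transformation is the number of elements in its domain. A restriction of $\alpha$ is a partial transformation $\alpha|_X$ with domain $X\subseteq\mathrm{Dom}(\alpha)$ that agrees with $\alpha$ on $X$. *)

(* Defs.v *)
From mathcomp Require Import all_boot.

Set Implicit Arguments.
Unset Strict Implicit.
Unset Printing Implicit Defensive.

(* The chain 1 < 2 < ... < n is represented by 'I_n, i.e. 0 < 1 < ... < n.-1;
   alpha x = None means that x lies outside the domain of alpha. *)
Notation PT n := {ffun 'I_n -> option 'I_n}.

Definition Dom (n : nat) (alpha : PT n) : {set 'I_n} :=
  [set x | alpha x != None].

Definition width (n : nat) (alpha : PT n) : nat := #|Dom alpha|.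

(* enum lists the elements of a {set 'I_n} in increasing order. *)
Definition image_seq (n : nat) (alpha : PT n) : seq 'I_n :=
  pmap alpha (enum (Dom alpha)).

(* ordS is the successor modulo size s, so the last entry of s is compared
   with its first one. *)
Definition cyclic_seq (n : nat) (s : seq 'I_n) : bool :=
  #|[set i : 'I_(size s) |
      tnth (in_tuple s) i > tnth (in_tuple s) (ordS i)]| <= 1.

Definition anticyclic_seq (n : nat) (s : seq 'I_n) : bool :=
  #|[set i : 'I_(size s) |
      tnth (in_tuple s) i < tnth (in_tuple s) (ordS i)]| <= 1.

Definition oriented_seq (n : nat) (s : seq 'I_n) : bool :=
  cyclic_seq s || anticyclic_seq s.

Definition SymInv (n : nat) : {set PT n} :=
  [set alpha : PT n |
    [forall x in Dom alpha, forall y in Dom alpha,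
      (alpha x == alpha y) ==> (x == y)]].

Definition POP (n : nat) : {set PT n} :=
  [set alpha : PT n | cyclic_seq (image_seq alpha)].

Definition POR (n : nat) : {set PT n} :=
  [set alpha : PT n | oriented_seq (image_seq alpha)].

Definition POPI (n : nat) : {set PT n} := POP n :&: SymInv n.

Definition PORI (n : nat) : {set PT n} := POR n :&: SymInv n.

(* The restriction of alpha to X, meant for X \subset Dom alpha. *)
Definition restr (n : nat) (alpha : PT n) (X : {set 'I_n}) : PT n :=
  [ffun x => if x \in X then alpha x else None].

(* Main.v *)
Require Import Defs.
From mathcomp Require Import all_boot.
From mathcomp Require Import zify.

(** With pairwise distinct entries, a sequence is cyclic iff each of its
    length-three subsequences is, which gives (1); reversing the order of the
    codomain gives the same for anti-cyclic sequences.  A partial permutation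
    of width three is either orientation-preserving or orientation-reversing,
    but not both.  Hence, when all restrictions of width four are oriented, two
    three-element subsets of the domain that differ by one exchange have the
    same orientation; any two such subsets are linked by exchanges, so all of
    them have the same orientation and (2) follows from (1). *)

Set Implicit Arguments.
Unset Strict Implicit.
Unset Printing Implicit Defensive.

(** * Cyclic sequences and the strict ternary cyclic order [cyc3] *)

Definition cyc3 (a b c : nat) : bool :=
  [|| a < b < c, b < c < a | c < a < b].

(** Trades the cardinality of a set of ordinals for plain natural indices, where [lia] can work;
    [ordS] becomes [i.+1 %% size s]. *)
Lemma cyclic_seqP n (s : seq 'I_n) (x0 : 'I_n) :
  reflect (forall i j, i < size s -> j < size s ->
             nth x0 s (i.+1 %% size s) < nth x0 s i ->
             nth x0 s (j.+1 %% size s) < nth x0 s j -> i = j)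
          (cyclic_seq s).
Proof.
apply: (iffP card_le1_eqP) => [H i j hi hj di dj|H i j].
  suff /(congr1 val) : Ordinal hi = Ordinal hj by [].
  by apply: H; rewrite inE !(tnth_nth x0).
rewrite !inE !(tnth_nth x0) /= => di dj; apply/val_inj.
exact: (H _ _ _ _ dj di).
Qed.

(** Without a descent between [i] and [j], [f] would be nondecreasing there. *)
Lemma ex_descent (f : nat -> nat) i j :
  i <= j -> f j < f i -> exists2 p, i <= p < j & f p.+1 < f p.
Proof.
rewrite leq_eqVlt => /predU1P[->|]; first by rewrite ltnn.
elim: j => [|j IH] // ij hf.
have [hj|hj] := ltnP (f j.+1) (f j); first by exists j => //; lia.
move: ij; rewrite ltnS leq_eqVlt => /predU1P[E|ij]; first by subst i; lia.
by have [|p hp dp] := IH ij; [lia|exists p => //; lia].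
Qed.

(** Left to right: positions [i < j < k] cut the cycle into three arcs, and a triple outside [cyc3]
    drops along two of them, each containing a descent. Right to left: descents at [p < q] are
    incompatible with the triples drawn from [p], [p.+1], [q], [q.+1], read modulo [t]. *)
Lemma descents_cyc3 (f : nat -> nat) t :
  {in gtn t &, injective f} ->
  (forall i j, i < t -> j < t -> f (i.+1 %% t) < f i ->
     f (j.+1 %% t) < f j -> i = j) <->
  (forall i j k, i < j -> j < k -> k < t -> cyc3 (f i) (f j) (f k)).
Proof.
move=> injf.
have neqf i j : i < j -> j < t -> f i <> f j.
  move=> ij jt E; suff : i = j by lia.
  by apply: injf => //; rewrite inE; lia.
have last_next p : p.+1 = t -> p.+1 %% t = 0 by move=> ->; rewrite modnn.
split=> [H i j k ij jk kt|H].
- have desc a b : a <= b -> b < t -> f b < f a ->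
      exists2 p, a <= p < b & f (p.+1 %% t) < f p.
    move=> ab bt /(ex_descent ab)[p hp dp]; exists p => //.
    by rewrite modn_small //; lia.
  (* The third arc runs from [k] through [t.-1] and [0] to [i]. If neither piece falls, then
     [f 0 <= f i < f k <= f t.-1], so the descent is at [t.-1]. *)
  have wrap : f i < f k ->
      exists2 p, (p < i) || (k <= p) & p < t /\ f (p.+1 %% t) < f p.
    move=> fik; have [hi|hi] := ltnP (f i) (f 0).
      have [||p hp dp] := desc 0 i _ _ hi; [lia|lia|].
      by exists p; [lia|split=> //; lia].
    have [hl|hl] := ltnP (f t.-1) (f k).
      have [||p hp dp] := desc k t.-1 _ _ hl; [lia|lia|].
      by exists p; [lia|split=> //; lia].
    exists t.-1; first lia.
    by split; [lia|rewrite last_next; lia].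
  have nij := neqf i j ij (ltn_trans jk kt).
  have njk := neqf j k jk kt.
  have nik := neqf i k (ltn_trans ij jk) kt.
  apply/negPn/negP => nc.
  (* If exactly one of the first two arcs falls, failure of [cyc3] forces [f i < f k], and [wrap]
     gives the second descent. *)
  have [hij|hij] := ltnP (f j) (f i); have [hjk|hjk] := ltnP (f k) (f j).
  + have [||p hp dp] := desc i j _ _ hij; [lia|lia|].
    have [||q hq dq] := desc j k _ _ hjk; [lia|lia|].
    by have := H p q _ _ dp dq; lia.
  + have [||p hp dp] := desc i j _ _ hij; [lia|lia|].
    have [|q hq [qt dq]] := wrap; first by move: nc; rewrite /cyc3; lia.
    by have := H p q _ _ dp dq; lia.
  + have [||p hp dp] := desc j k _ _ hjk; [lia|lia|].
    have [|q hq [qt dq]] := wrap; first by move: nc; rewrite /cyc3; lia.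
    by have := H p q _ _ dp dq; lia.
  + by move: nc; rewrite /cyc3; lia.
suff W p q : p < q -> q < t -> f (p.+1 %% t) < f p ->
    f (q.+1 %% t) < f q -> False.
  move=> i j it jt di dj; have [ij|ji|//] := ltngtP i j.
    by case: (W i j).
  by case: (W j i).
move=> pq qt; rewrite modn_small; last lia.
have [qt1|qt1] : q.+1 < t \/ q.+1 = t by lia.
- rewrite modn_small // => dp dq.
  have [E|pq1] : p.+1 = q \/ p.+1 < q by lia.
    by subst q; have := H p p.+1 p.+2; rewrite /cyc3; lia.
  (* The triples starting with [p], [p.+1] put [f q] and [f q.+1] strictly between [f p.+1] and
     [f p]; the triple [p], [q], [q.+1] then forces [f q < f q.+1]. *)
  have := H p p.+1 q; have := H p p.+1 q.+1; have := H p q q.+1.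
  by rewrite /cyc3; lia.
rewrite last_next // => dp dq.
have [p0|p0] := posnP p.
  subst p; have [q1|q1] : q = 1 \/ 1 < q by lia.
    by subst q; lia.
  by have := H 0 1 q; rewrite /cyc3; lia.
have [E|pq1] : p.+1 = q \/ p.+1 < q by lia.
  by subst q; have := H 0 p p.+1; rewrite /cyc3; lia.
(* Since [f 0 < f q], both [f p] and [f p.+1] exceed [f 0]; the triple [0], [p], [p.+1] then
   excludes a descent at [p]. *)
have := H 0 p q; have := H 0 p.+1 q; have := H 0 p p.+1.
by rewrite /cyc3; lia.
Qed.

Lemma cyclic_seq_cyc3 n (s : seq 'I_n) (x0 : 'I_n) : uniq s ->
  cyclic_seq s <->
  (forall i j k, i < j -> j < k -> k < size s ->
     cyc3 (nth x0 s i) (nth x0 s j) (nth x0 s k)).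
Proof.
move=> us.
have inj : {in gtn (size s) &, injective (fun i => nat_of_ord (nth x0 s i))}.
  by move=> i j hi hj /val_inj/eqP; rewrite nth_uniq // => /eqP.
have D := descents_cyc3 inj.
by split=> [/(cyclic_seqP s x0)/D|/D/(cyclic_seqP s x0)].
Qed.

(** [rev_ord] reverses the strict order, so descents become ascents at the same indices. *)
Lemma cyclic_seq_rev n (s : seq 'I_n) :
  cyclic_seq (map (@rev_ord n) s) = anticyclic_seq s.
Proof.
case: s => [|x0 s'].
  by rewrite /cyclic_seq /anticyclic_seq !eq_card0 // => -[].
set s := x0 :: s'.
have rev_lt (a b : 'I_n) : (rev_ord a < rev_ord b) = (b < a).
  by have := ltn_ord a; have := ltn_ord b; rewrite /=; lia.
have st : 0 < size s by [].
apply/(cyclic_seqP _ (rev_ord x0))/card_le1_eqP; rewrite size_map => H i j.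
- rewrite !inE !(tnth_nth x0) /= => di dj; apply/val_inj.
  by apply: (H _ _ (ltn_ord j) (ltn_ord i));
    rewrite !(nth_map x0) ?ltn_mod ?rev_lt.
- move=> hi hj; rewrite !(nth_map x0) ?ltn_mod // !rev_lt => di dj.
  suff /(congr1 val) : Ordinal hi = Ordinal hj by [].
  by apply: H; rewrite inE !(tnth_nth x0).
Qed.

(** Up to rotation, three distinct values are either increasing or decreasing. *)
Lemma anticyclic_seq3 n (s : seq 'I_n) :
  uniq s -> size s = 3 -> anticyclic_seq s = ~~ cyclic_seq s.
Proof.
case: s => [|x [|y [|z []]]] // us _; set s := [:: x; y; z].
have usr : uniq (map (@rev_ord n) s).
  by rewrite map_inj_uniq //; apply: rev_ord_inj.
have three (u v w : 'I_n) : uniq [:: u; v; w] ->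
    cyclic_seq [:: u; v; w] = cyc3 u v w.
  move=> uu; apply/idP/idP => [|H].
    by move/(cyclic_seq_cyc3 u uu)/(_ 0 1 2); apply.
  apply/(cyclic_seq_cyc3 u uu) => i j k ij jk /= kt.
  by have [-> -> ->] : [/\ i = 0, j = 1 & k = 2] by split; lia.
rewrite -cyclic_seq_rev three // [RHS]/= three // /cyc3 /=.
have := us; rewrite /= !inE -!val_eqE /=.
by have := ltn_ord x; have := ltn_ord y; have := ltn_ord z; lia.
Qed.

(** * Partial transformations and their image sequences *)

Section PartialTransformations.

Variable n : nat.
Implicit Types (alpha : PT n) (X Y : {set 'I_n}).

Lemma in_Dom alpha x : (x \in Dom alpha) = (alpha x != None).
Proof. by rewrite inE. Qed.

Lemma SymInvP alpha :
  reflect {in Dom alpha &, injective alpha} (alpha \in SymInv n).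
Proof.
rewrite inE; apply: (iffP forall_inP) => H x; last first.
  by move=> xD; apply/forall_inP => y yD; apply/implyP => /eqP/H->.
move=> y /H/forall_inP Hx /Hx/implyP H' E.
by apply/eqP/H'/eqP.
Qed.

(** On its domain [alpha] never returns [None], so [pmap] discards nothing. *)
Lemma map_Some_image_seq alpha :
  map some (image_seq alpha) = map alpha (enum (Dom alpha)).
Proof.
rewrite /image_seq pmapS_filter; congr map; apply/all_filterP/allP => x.
by rewrite mem_enum in_Dom /=; case: (alpha x).
Qed.

Lemma size_image_seq alpha : size (image_seq alpha) = width alpha.
Proof. by rewrite -(size_map some) map_Some_image_seq size_map -cardE. Qed.

Lemma image_seq_uniq alpha : alpha \in SymInv n -> uniq (image_seq alpha).
Proof.
move/SymInvP => inj; rewrite -(map_inj_uniq (f := some)); last by move=> ? ? [].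
rewrite map_Some_image_seq map_inj_in_uniq ?enum_uniq // => x y.
by rewrite !mem_enum; apply: inj.
Qed.

Lemma nth_image_seq alpha x0 i : i < width alpha ->
  alpha (nth x0 (enum (Dom alpha)) i) = Some (nth x0 (image_seq alpha) i).
Proof.
move=> hi; rewrite -(nth_map _ (Some x0)) -?cardE //.
by rewrite -map_Some_image_seq (nth_map x0) // size_image_seq.
Qed.

Lemma sorted_enum_set X : sorted (relpre val ltn) (enum X).
Proof.
rewrite {1}/enum_mem; apply: sorted_filter => [y x z /=|].
  exact: ltn_trans.
by rewrite -sorted_map -enumT val_enum_ord iota_ltn_sorted.
Qed.

Lemma ltn_nth_enum X x0 i j : i < #|X| -> j < #|X| ->
  (nth x0 (enum X) i < nth x0 (enum X) j) = (i < j).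
Proof.
move=> hi hj; have mono a b :
    a < b -> b < #|X| -> nth x0 (enum X) a < nth x0 (enum X) b.
  move=> ab hb; have ha := ltn_trans ab hb; move: ab.
  apply: (sorted_ltn_nth (leT := relpre val ltn)) (sorted_enum_set X) _ _ _ _;
    rewrite ?inE -?cardE //.
  by move=> y x z /=; apply: ltn_trans.
case: (ltngtP i j) => [ij|ji|->]; [exact: mono| |exact: ltnn].
by have := mono _ _ ji hi; lia.
Qed.

(** [enum (Dom alpha)] is increasing, so increasing triples of positions correspond to increasing
    triples of points of the domain. *)
Lemma POP_cyc3 alpha : alpha \in SymInv n ->
  alpha \in POP n <->
  (forall x y z a b c : 'I_n, x < y -> y < z ->
     alpha x = Some a -> alpha y = Some b -> alpha z = Some c -> cyc3 a b c).
Proof.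
move=> inj; have us := image_seq_uniq inj; rewrite inE; split=> H.
- move=> x y z a b c xy yz ax ay az.
  have /(cyclic_seq_cyc3 x us) {}H := H; rewrite size_image_seq in H.
  have idx w d : alpha w = Some d -> exists i,
      [/\ i < width alpha, nth x (enum (Dom alpha)) i = w
        & nth x (image_seq alpha) i = d].
    move=> aw; have wD : w \in enum (Dom alpha) by rewrite mem_enum in_Dom aw.
    have hi : index w (enum (Dom alpha)) < width alpha.
      by rewrite /width cardE index_mem.
    have nthw := nth_index x wD.
    exists (index w (enum (Dom alpha))); split=> //.
    by have := nth_image_seq x hi; rewrite nthw aw => -[].
  have [i [hi xi <-]] := idx x a ax; have [j [hj yj <-]] := idx y b ay.
  have [k [hk zk <-]] := idx z c az.
  apply: H => //; first by rewrite -(ltn_nth_enum x hi hj) xi yj.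
  by rewrite -(ltn_nth_enum x hj hk) yj zk.
(* A nonempty image sequence supplies the default element for [nth]; the empty one is cyclic
   outright. *)
- have [->|[x0 _]] : image_seq alpha = [::] \/ exists x, x \in image_seq alpha.
    case: (image_seq alpha) => [|x s]; first by left.
    by right; exists x; rewrite mem_head.
    by rewrite /cyclic_seq eq_card0 // => -[].
  apply/(cyclic_seq_cyc3 x0 us) => i j k ij jk; rewrite size_image_seq => hk.
  have hj := ltn_trans jk hk; have hi := ltn_trans ij hj.
  by apply: H (nth_image_seq x0 hi) (nth_image_seq x0 hj) (nth_image_seq x0 hk);
    rewrite ltn_nth_enum.
Qed.

(** * Restrictions *)

Lemma Dom_restr alpha X : X \subset Dom alpha -> Dom (restr alpha X) = X.
Proof.
move/subsetP => XD; apply/setP => x; rewrite in_Dom ffunE.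
by case: ifP => // /XD; rewrite in_Dom.
Qed.

Lemma width_restr alpha X : X \subset Dom alpha -> width (restr alpha X) = #|X|.
Proof. by move=> XD; rewrite /width Dom_restr. Qed.

Lemma restr_restr alpha X Y :
  X \subset Y -> restr (restr alpha Y) X = restr alpha X.
Proof.
by move/subsetP => XY; apply/ffunP => x; rewrite !ffunE; case: ifP => // /XY->.
Qed.

Lemma restr_SymInv alpha X : alpha \in SymInv n -> restr alpha X \in SymInv n.
Proof.
move/SymInvP => inj; apply/SymInvP => x y; rewrite !in_Dom !ffunE.
by case: ifP => // _; case: ifP => // _ ax ay; apply: inj; rewrite in_Dom.
Qed.

(** The criterion [POP_cyc3] looks at three points at a time, so it only sees restrictions to
    three-element sets. *)
Lemma POP_restr3 alpha : alpha \in SymInv n ->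
  alpha \in POP n <->
  (forall X, X \subset Dom alpha -> #|X| = 3 -> restr alpha X \in POP n).
Proof.
move=> inj; rewrite (POP_cyc3 inj); split=> H.
- move=> X _ _; apply/(POP_cyc3 (restr_SymInv X inj)) => x y z a b c xy yz.
  by rewrite !ffunE; do 3![case: ifP => // _]; apply: H.
- move=> x y z a b c xy yz ax ay az.
  have XD : [set x; y; z] \subset Dom alpha.
    apply/subsetP => w; rewrite !inE -orbA.
    by case/or3P=> /eqP->; rewrite ?ax ?ay ?az.
  have X3 : #|[set x; y; z]| = 3.
    rewrite setUC cardsU1 cards2 !inE -!val_eqE /=; lia.
  have /(POP_cyc3 (restr_SymInv _ inj)) {}H := H _ XD X3.
  by apply: (H x y z) => //; rewrite ffunE !inE eqxx ?orbT.
Qed.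

(** * Reversal of the codomain, which exchanges the two orientations *)

Definition rev_cod alpha : PT n := [ffun x => omap (@rev_ord n) (alpha x)].

Lemma Dom_rev_cod alpha : Dom (rev_cod alpha) = Dom alpha.
Proof. by apply/setP => x; rewrite !in_Dom ffunE; case: (alpha x). Qed.

Lemma restr_rev_cod alpha X : restr (rev_cod alpha) X = rev_cod (restr alpha X).
Proof. by apply/ffunP => x; rewrite !ffunE; case: ifP. Qed.

Lemma rev_cod_SymInv alpha : alpha \in SymInv n -> rev_cod alpha \in SymInv n.
Proof.
move/SymInvP => inj; apply/SymInvP => x y; rewrite Dom_rev_cod => xD yD.
rewrite !ffunE => /(inj_omap (@rev_ord_inj n)); exact: inj.
Qed.

Lemma rev_cod_POP alpha :
  (rev_cod alpha \in POP n) = anticyclic_seq (image_seq alpha).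
Proof.
rewrite inE -cyclic_seq_rev; congr cyclic_seq.
(* Under the injective [some], both image sequences become plain maps over the same enumerated
   domain. *)
apply: (inj_map (f := some)) => [? ? []//|].
transitivity (map (omap (@rev_ord n)) (map some (image_seq alpha))); last first.
  by rewrite -!map_comp.
rewrite !map_Some_image_seq Dom_rev_cod -map_comp.
by apply: eq_map => x; rewrite /= ffunE.
Qed.

Lemma POR_rev_cod alpha :
  (alpha \in POR n) = (alpha \in POP n) || (rev_cod alpha \in POP n).
Proof. by rewrite rev_cod_POP !inE. Qed.

Lemma rev_cod_POP3 alpha : alpha \in SymInv n -> width alpha = 3 ->
  (rev_cod alpha \in POP n) = (alpha \notin POP n).
Proof.
move=> inj w3; rewrite rev_cod_POP inE anticyclic_seq3 ?image_seq_uniq //.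
by rewrite size_image_seq.
Qed.

End PartialTransformations.

(** * Exchanges between subsets of equal size *)

Lemma exchange_ind (T : finType) (D : {set T}) (P : {set T} -> Prop) :
  (forall (X : {set T}) x y, X \subset D -> x \in X -> y \in D -> y \notin X ->
     P X -> P (y |: X :\ x)) ->
  forall X Y : {set T},
    X \subset D -> Y \subset D -> #|X| = #|Y| -> P X -> P Y.
Proof.
(* Induction on the size of [Y :\: X]: replacing some [x] of [X] outside [Y] by some [y] of [Y]
   outside [X] keeps the cardinality and shrinks this difference. *)
move=> step X Y; have [m] := ubnP #|Y :\: X|.
elim: m X => // m IH X; rewrite ltnS => le_m XD YD cXY PX.
have [YX|/subsetPn[y yY yX]] := boolP (Y \subset X).
  suff -> : Y = X by [].
  by apply/eqP; rewrite eqEcard YX cXY leqnn.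
have /subsetPn[x xX xY] : ~~ (X \subset Y).
  apply: contraNN yX => XY; suff -> : X = Y by [].
  by apply/eqP; rewrite eqEcard XY cXY leqnn.
have yD := subsetP YD y yY.
apply: (IH (y |: X :\ x)) => //; last exact: step.
- apply: leq_trans le_m; apply: proper_card; apply/properP; split.
    apply/subsetP => z; rewrite !inE negb_or negb_and negbK.
    case: (z =P x) => [->|_]; first by rewrite (negPf xY) andbF.
    by move=> /= /andP[/andP[_ ->]].
  by exists y; rewrite !inE ?eqxx ?yX ?yY.
- by rewrite subUset sub1set yD (subset_trans (subsetDl _ _)).
- by rewrite cardsU1 !inE (negPf yX) andbF -cXY [in RHS](cardsD1 x) xX.
Qed.

Lemma restr3_POP_exchange n (alpha : PT n) : alpha \in SymInv n ->
  (forall X : {set 'I_n}, X \subset Dom alpha -> #|X| = 4 ->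
     restr alpha X \in POR n) ->
  forall X Y : {set 'I_n},
    X \subset Dom alpha -> Y \subset Dom alpha -> #|X| = 3 -> #|Y| = 3 ->
    restr alpha X \in POP n -> restr alpha Y \in POP n.
Proof.
move=> inj H X Y XD YD X3 Y3 PX.
pose P (Z : {set 'I_n}) := #|Z| = 3 /\ restr alpha Z \in POP n.
suff [] : P Y by [].
apply: (exchange_ind (D := Dom alpha) (P := P)) XD YD _ _; rewrite ?X3 ?Y3 //.
move=> Z x y ZD xZ yD yZ [Z3 PZ].
have UD : y |: Z \subset Dom alpha by rewrite subUset sub1set yD.
have ZU : Z \subset y |: Z by apply: subsetUr.
have Z'U : y |: Z :\ x \subset y |: Z by apply/setUS/subsetDl.
have Z'3 : #|y |: Z :\ x| = 3.
  by rewrite cardsU1 !inE (negPf yZ) andbF -Z3 [in RHS](cardsD1 x) xZ.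
split=> //; have U4 : #|y |: Z| = 4 by rewrite cardsU1 yZ Z3.
have injU := restr_SymInv (y |: Z) inj.
(* Both triples lie in [y |: Z]. If its restriction preserves orientation, so does the one to the
   new triple; if it reverses orientation, so does the one to [Z], against [PZ]. *)
have := H _ UD U4; rewrite POR_rev_cod => /orP[|].
- move/(POP_restr3 injU)/(_ (y |: Z :\ x)).
  by rewrite Dom_restr // restr_restr //; apply.
- move/(POP_restr3 (rev_cod_SymInv injU))/(_ Z).
  rewrite Dom_rev_cod Dom_restr // restr_rev_cod restr_restr // => /(_ ZU Z3).
  by rewrite rev_cod_POP3 ?restr_SymInv ?width_restr // PZ.
Qed.

Lemma POR_restr4 n (alpha : PT n) : alpha \in SymInv n ->
  alpha \in POR n <->
  (forall X : {set 'I_n}, X \subset Dom alpha -> #|X| = 4 ->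
     restr alpha X \in POR n).
Proof.
move=> inj; have rinj := rev_cod_SymInv inj; split=> [|H].
- rewrite POR_rev_cod => H X XD _; rewrite POR_rev_cod -restr_rev_cod.
  have sub Y : Y \subset Dom (restr alpha X) -> Y \subset X.
    by rewrite Dom_restr.
  case/orP: H => [/(POP_restr3 inj)|/(POP_restr3 rinj)] H; apply/orP;
    [left|right].
  + apply/(POP_restr3 (restr_SymInv X inj)) => Y /sub YX Y3.
    by rewrite restr_restr //; apply: H => //; apply: subset_trans XD.
  + apply/(POP_restr3 (restr_SymInv X rinj)) => Y.
    rewrite restr_rev_cod Dom_rev_cod -restr_rev_cod => /sub YX Y3.
    rewrite restr_restr //; apply: H => //.
    by rewrite Dom_rev_cod; apply: subset_trans XD.
- have link := restr3_POP_exchange inj H.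
  rewrite POR_rev_cod; apply/orP.
  (* One orientation-preserving triple makes all of them so through [link]; otherwise every triple
     is reversing, vacuously when the domain has fewer than three points. *)
  have [/existsP[X /and3P[XD /eqP X3 PX]]|none] := boolP
      [exists X : {set 'I_n}, [&& X \subset Dom alpha, #|X| == 3
                                & restr alpha X \in POP n]].
    left; apply/(POP_restr3 inj) => Y YD Y3; exact: (link X Y).
  right; apply/(POP_restr3 rinj) => Y; rewrite Dom_rev_cod => YD Y3.
  rewrite restr_rev_cod rev_cod_POP3 ?restr_SymInv ?width_restr //.
  by apply: contraNN none => PY; apply/existsP; exists Y; rewrite YD Y3 PY.
Qed.

Theorem theorem1p7 (n : nat) (hn : 1 <= n) (alpha : PT n)
    (halpha : alpha \in SymInv n) :
  (alpha \in POPI n <->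
     (forall X : {set 'I_n}, X \subset Dom alpha ->
        width (restr alpha X) = 3 -> restr alpha X \in POPI n)) /\
  (alpha \in PORI n <->
     (forall X : {set 'I_n}, X \subset Dom alpha ->
        width (restr alpha X) = 4 -> restr alpha X \in PORI n)).
Proof.
(* Restrictions inherit injectivity, so only membership in [POP] or [POR] remains to be compared. *)
have inI (A : {set PT n}) (beta : PT n) : beta \in SymInv n ->
    (beta \in A :&: SymInv n) = (beta \in A) by move=> b; rewrite inE b andbT.
rewrite /POPI /PORI !inI //; split.
- apply: iff_trans (POP_restr3 halpha) _.
  by split=> H X XD; have := H X XD; rewrite width_restr // inI ?restr_SymInv.
- apply: iff_trans (POR_restr4 halpha) _.
  by split=> H X XD; have := H X XD; rewrite width_restr // inI ?restr_SymInv.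
Qed.
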